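(* Let $p,q,r$ be integers, each $\ge 3$, pairwise coprime, and let $\theta=\{p,q,r\}$. Define \[ Q_\theta(z)=\frac{(z^{pqr}-1)(z^{p}-1)(z^{q}-1)(z^{r}-1)}{(z^{qr}-1)(z^{rp}-1)(z^{pq}-1)(z-1)}, \] which is a polynomial of degree $\varphi(\theta)=(p-1)(q-1)(r-1)$; write $Q_\theta(z)=\sum_{m=0}^{\varphi(\theta)}a_m(\theta)z^m$, let $\mathcal A_\theta=\{a_m(\theta):0\le m\le\varphi(\theta)\}$ be its set of coefficients, and let $A^+(\theta)=\max_m a_m(\theta)$, $A^-(\theta)=\min_m a_m(\theta)$. Then \[ \mathcal A_\theta=[A^-(\theta),A^+(\theta)]\cap\mathbb Z . \] Moreover, if $r,s>\max(p,q)$, where $s$ is also an integer such that $p,q,s$ are pairwise coprime, then \[ \mathcal A_{\{p,q,r\}}=\begin{cases}\mathcal A_{\{p,q,s\}}, & \text{if } r\equiv s\pmod{pq},\\ -\mathcal A_{\{p,q,s\}}, & \text{if } r\equiv -s\pmod{pq},\end{cases} \] where $-\mathcal A=\{-a:a\in\mathcal A\}$. *)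

(* Defs.v *)
From mathcomp Require Import all_boot all_order all_algebra.
From mathcomp Require Import boolp classical_sets.

Set Implicit Arguments.
Unset Strict Implicit.
Unset Printing Implicit Defensive.

Import Order.TTheory GRing.Theory Num.Theory.
Local Open Scope classical_set_scope.
Local Open Scope ring_scope.

Definition Qnum (p q r : nat) : {poly int} :=
  ('X^(p * q * r) - 1) * ('X^p - 1) * ('X^q - 1) * ('X^r - 1).

Definition Qden (p q r : nat) : {poly int} :=
  ('X^(q * r) - 1) * ('X^(r * p) - 1) * ('X^(p * q) - 1) * ('X - 1).

(* [%/] discards the remainder of Euclidean division by the monic [Qden];
   this is the quotient of the two polynomials when [Qden] divides [Qnum]. *)
Definition Qpoly (p q r : nat) : {poly int} := Qnum p q r %/ Qden p q r.

Definition phi (p q r : nat) : nat := (p.-1 * q.-1 * r.-1)%N.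

Definition coef_set (p q r : nat) : set int :=
  [set (Qpoly p q r)`_m | m in [set m : nat | (m <= phi p q r)%N]].

(* The neutral value of the iterated max/min is the coefficient of index 0,
   itself one of the coefficients ranged over. *)
Definition Aplus (p q r : nat) : int :=
  \big[Num.max/(Qpoly p q r)`_0]_(m < (phi p q r).+1) (Qpoly p q r)`_m.

Definition Aminus (p q r : nat) : int :=
  \big[Num.min/(Qpoly p q r)`_0]_(m < (phi p q r).+1) (Qpoly p q r)`_m.

(* Main.v *)
Require Import Defs.
From mathcomp Require Import all_boot all_order all_algebra.
From mathcomp Require Import boolp classical_sets.
From mathcomp Require Import zify ring.

Import Order.TTheory GRing.Theory Num.Theory.
Local Open Scope classical_set_scope.
Local Open Scope ring_scope.

Set Implicit Arguments.
Unset Strict Implicit.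
Unset Printing Implicit Defensive.

(* Let Q_pq be the binary polynomial (z^pq - 1)(z - 1) / ((z^p - 1)(z^q - 1)),
   with coefficients c_m. Then Q_pqr(z) = Q_pq(z^r) / Q_pq(z), and expanding
   1 / Q_pq gives a_n = sum of c_m chi(n - r m) over m <= n / r, where chi has
   period pq and equals [i < p] - [q <= i < q + p] on 0 <= i < pq.
   Let S(x, t) be the sum of c_m chi(x - r m) over m < t.

   - Each difference S(x, t) - S(x - 1, t) is an alternating sum of four
     truncated coefficients c, at the corners of a rectangle in the coordinates
     m = u p + v q mod pq; the explicit form of c bounds it by 1 in absolute
     value. So consecutive a_n differ by at most 1 and fill an interval.

   - S depends on r modulo pq only, so it remains to see that for r > max(p, q)
     the numbers S(x, t) with arbitrary x and t are the coefficients a_n. By the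
     first point it is enough that S(x, t) lies between the extreme a_n. If
     adding the term of index t increases S, take n = r t + i congruent to x
     with 0 <= i < pq. When i < r, the new sum is a_n. Otherwise
     q <= i < p + q and c_t = -1; since the nonzero c alternate in sign,
     c_(t+1) >= 0, and adding the next term c_(t+1) chi(i - r) = c_(t+1) to the
     new sum gives a_n, which is at least as large. Decreases are symmetric.

   - Replacing r by -r negates the set of values of S, as c is palindromic and
     the complete sums S(x, t), t > deg Q_pq, vanish. *)

(** * Bezout coefficients and an indicator sum *)

Lemma bezout_pos (p q : nat) : (1 < p)%N -> (1 < q)%N -> coprime p q ->
  exists mu la : nat,
    [/\ (0 < mu < q)%N, (0 < la < p)%N & (mu * p + la * q = (p * q).+1)%N].
Proof.
move=> p1 q1 cpq; case: (@egcdnP p q (ltnW p1)) => km kn.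
rewrite (eqP cpq) muln1 => e lt_kn.
have kn0 : (0 < kn)%N.
  case: kn e {lt_kn} => // /eqP; rewrite mul0n add0n muln_eq1.
  by case/andP=> _ /eqP e; move: p1; rewrite e.
have km_q : (km * p < q * p)%N.
  apply: (@leq_trans (kn.+1 * q)%N); last by rewrite mulnC leq_mul2l lt_kn orbT.
  rewrite e mulSn; lia.
rewrite ltn_mul2r in km_q; case/andP: km_q => _ km_q.
have le_kn : (kn * q <= p * q)%N by rewrite leq_mul2r ltnW ?orbT.
(* From km p = kn q + 1, the choice p - kn gives km p + (p - kn) q = pq + 1. *)
exists km, (p - kn)%N; split; [|lia|rewrite e mulnBl; lia].
by rewrite km_q andbT; case: km e {km_q} => //; lia.
Qed.

Lemma sum_eq_ord (n u : nat) :
  \sum_(i < n) (i == u :> nat)%:R = (u < n)%N%:R :> int.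
Proof.
case: ltnP => un; last first.
  by rewrite big1 // => i _; have := ltn_ord i; case: eqP => // e; lia.
rewrite (bigD1 (Ordinal un)) //= eqxx big1 ?addr0 // => i /eqP ne.
by case: eqP => // e; case: ne; apply: val_inj.
Qed.

(** * The binary polynomial in coordinates modulo pq *)

Section BinaryPolynomial.

Variables p q mu la : nat.
Hypotheses (p_gt2 : (2 < p)%N) (q_gt2 : (2 < q)%N).
Hypotheses (mu_bnd : (0 < mu < q)%N) (la_bnd : (0 < la < p)%N).
Hypothesis bezout : (mu * p + la * q = (p * q).+1)%N.

(* y = U p + V q mod pq, where U < q and V < p: by [bezout], mu is inverse to p
   mod q and la to q mod p. *)
Definition Ucoord (y : int) : nat := `|((y * mu%:Z) %% q%:Z)%Z|%N.
Definition Vcoord (y : int) : nat := `|((y * la%:Z) %% p%:Z)%Z|%N.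

Lemma Ucoord_lt y : (Ucoord y < q)%N.
Proof.
have q0 : q%:Z != 0 by lia.
have := ltz_mod (y * mu%:Z) q0; have := modz_ge0 (y * mu%:Z) q0.
rewrite /Ucoord; lia.
Qed.

Lemma Vcoord_lt y : (Vcoord y < p)%N.
Proof.
have p0 : p%:Z != 0 by lia.
have := ltz_mod (y * la%:Z) p0; have := modz_ge0 (y * la%:Z) p0.
rewrite /Vcoord; lia.
Qed.

Lemma coordE y : exists k : int,
  y = (Ucoord y * p)%N%:Z + (Vcoord y * q)%N%:Z + k * (p * q)%N%:Z.
Proof.
have p0 : p%:Z != 0 by lia.
have q0 : q%:Z != 0 by lia.
have := divz_eq (y * mu%:Z) q%:Z; have := divz_eq (y * la%:Z) p%:Z.
have : (Ucoord y)%:Z = ((y * mu%:Z) %% q%:Z)%Z.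
  by rewrite gez0_abs ?modz_ge0.
have : (Vcoord y)%:Z = ((y * la%:Z) %% p%:Z)%Z.
  by rewrite gez0_abs ?modz_ge0.
move: (Ucoord y) (Vcoord y) => u v <- <-.
move: (_ %/ _)%Z (_ %/ _)%Z => b a eb ea.
have bz : mu%:Z * p%:Z + la%:Z * q%:Z = p%:Z * q%:Z + 1 by lia.
(* Multiplying [bz] by y and inserting both divisions gives y (pq + 1) = u p + v q + (a + b) pq. *)
exists (a + b - y); rewrite !PoszM.
have : y * (mu%:Z * p%:Z + la%:Z * q%:Z) = y * (p%:Z * q%:Z + 1) by rewrite bz.
rewrite mulrDr !mulrA ea eb; lia.
Qed.

Lemma Ucoord_uniq (u v : nat) (k y : int) : (u < q)%N ->
  y = (u * p)%N%:Z + (v * q)%N%:Z + k * (p * q)%N%:Z -> Ucoord y = u.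
Proof.
move=> uq ->; rewrite /Ucoord.
have bz : p%:Z * mu%:Z = p%:Z * q%:Z + 1 - la%:Z * q%:Z by lia.
have -> : ((u * p)%N%:Z + (v * q)%N%:Z + k * (p * q)%N%:Z) * mu%:Z =
  (u%:Z * p%:Z - u%:Z * la%:Z + v%:Z * mu%:Z + k * p%:Z * mu%:Z) * q%:Z + u%:Z.
  rewrite !PoszM.
  transitivity (u%:Z * (p%:Z * mu%:Z) +
    (v%:Z * q%:Z + k * (p%:Z * q%:Z)) * mu%:Z).
    ring.
  rewrite bz; ring.
rewrite modzMDl modz_small //; lia.
Qed.

Lemma Vcoord_uniq (u v : nat) (k y : int) : (v < p)%N ->
  y = (u * p)%N%:Z + (v * q)%N%:Z + k * (p * q)%N%:Z -> Vcoord y = v.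
Proof.
move=> vp ->; rewrite /Vcoord.
have bz : q%:Z * la%:Z = p%:Z * q%:Z + 1 - mu%:Z * p%:Z by lia.
have -> : ((u * p)%N%:Z + (v * q)%N%:Z + k * (p * q)%N%:Z) * la%:Z =
  (v%:Z * q%:Z - v%:Z * mu%:Z + u%:Z * la%:Z + k * q%:Z * la%:Z) * p%:Z + v%:Z.
  rewrite !PoszM.
  transitivity (v%:Z * (q%:Z * la%:Z) +
    (u%:Z * p%:Z + k * (p%:Z * q%:Z)) * la%:Z).
    ring.
  rewrite bz; ring.
rewrite modzMDl modz_small //; lia.
Qed.

(** Locates u p + v q within the periods: the corner (mu, la) has value pq + 1 and the corner (q, p)
    has value 2pq. *)
Lemma lt_mulD (a b u v : nat) : (u < a)%N -> (v < b)%N ->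
  (u * p + v * q + p + q <= a * p + b * q)%N.
Proof.
move=> ua vb; have := leq_mul ua (leqnn p); have := leq_mul vb (leqnn q); lia.
Qed.

Lemma eq_mod_small (N x y k : int) :
  0 <= x < N -> 0 <= y < N -> x = y + k * N -> x = y.
Proof.
move=> hx hy e; have := congr1 (fun z => (z %% N)%Z) e.
by rewrite addrC modzMDl !modz_small.
Qed.

Lemma coord_low y : 0 <= y < (p * q)%N%:Z ->
  (Ucoord y < mu)%N -> (Vcoord y < la)%N ->
  y = (Ucoord y * p)%N%:Z + (Vcoord y * q)%N%:Z.
Proof.
move=> hy ul vl; have [k e] := coordE y; have := lt_mulD ul vl.
by move=> h; apply: eq_mod_small hy _ e; lia.
Qed.

(** Here pq < mu p + la q <= u p + v q < 2pq, so exactly one period is taken off. *)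
Lemma coord_high y : 0 <= y < (p * q)%N%:Z ->
  (mu <= Ucoord y)%N -> (la <= Vcoord y)%N ->
  y = (Ucoord y * p)%N%:Z + (Vcoord y * q)%N%:Z - (p * q)%N%:Z.
Proof.
move=> hy ul vl; have [k e] := coordE y.
have := lt_mulD (Ucoord_lt y) (Vcoord_lt y).
have hu := leq_mul ul (leqnn p); have hv := leq_mul vl (leqnn q).
move=> h; apply: (@eq_mod_small (p * q)%N%:Z _ _ (k + 1)) => //; first by lia.
by rewrite {1}e; ring.
Qed.

(** By [bezout], 1 has coordinates (mu, la), so passing to y - 1 subtracts mu modulo q from the
    first coordinate and la modulo p from the second. *)
Lemma UcoordB1 y :
  Ucoord (y - 1) = if (Ucoord y < mu)%N then (Ucoord y + q - mu)%N
                   else (Ucoord y - mu)%N.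
Proof.
have [k e] := coordE y; have uq := Ucoord_lt y; case: ltnP => h.
  have hm : (mu * p <= (Ucoord y + q) * p)%N by rewrite leq_mul2r; lia.
  apply: (@Ucoord_uniq _ (Vcoord y + p - la)%N (k - 1)); first by lia.
  have hv : (la * q <= (Vcoord y + p) * q)%N by rewrite leq_mul2r; lia.
  by rewrite {1}e !mulnBl -!subzn // !mulnDl; lia.
have hm : (mu * p <= Ucoord y * p)%N by rewrite leq_mul2r; lia.
apply: (@Ucoord_uniq _ (Vcoord y + p - la)%N k); first by lia.
have hv : (la * q <= (Vcoord y + p) * q)%N by rewrite leq_mul2r; lia.
by rewrite {1}e !mulnBl -!subzn // !mulnDl; lia.
Qed.

Lemma VcoordB1 y :
  Vcoord (y - 1) = if (Vcoord y < la)%N then (Vcoord y + p - la)%N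
                   else (Vcoord y - la)%N.
Proof.
have [k e] := coordE y; have vp := Vcoord_lt y; have uq := Ucoord_lt y.
have hm : (mu * p <= (Ucoord y + q) * p)%N by rewrite leq_mul2r; lia.
case: ltnP => h.
  apply: (@Vcoord_uniq (Ucoord y + q - mu)%N _ (k - 1)); first by lia.
  have hv : (la * q <= (Vcoord y + p) * q)%N by rewrite leq_mul2r; lia.
  by rewrite {1}e !mulnBl -!subzn // !mulnDl; lia.
have hv : (la * q <= Vcoord y * q)%N by rewrite leq_mul2r; lia.
apply: (@Vcoord_uniq (Ucoord y + q - mu)%N _ k); first by lia.
by rewrite {1}e !mulnBl -!subzn // !mulnDl; lia.
Qed.

(** Closed form of the coefficients of Q_pq, read modulo pq: 1 on the low rectangle u < mu, v < la,
    -1 on the opposite high rectangle, 0 on the two mixed ones. *)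
Definition bincoef (y : int) : int :=
  (Ucoord y < mu)%N%:R + (Vcoord y < la)%N%:R - 1.

Definition binpoly : {poly int} := \poly_(m < p * q) bincoef m%:Z.

(** An exponent i p + j q with i < q and j < p has coordinates i and j, so no monomial occurs twice
    in the product. *)
Lemma rectangle_coef (a b m : nat) : (a <= q)%N -> (b <= p)%N ->
  ((\sum_(i < a) ('X^p) ^+ i) * (\sum_(j < b) ('X^q) ^+ j) : {poly int})`_m =
  [&& (Ucoord m < a)%N, (Vcoord m < b)%N
    & (m == Ucoord m * p + Vcoord m * q)%N]%:R.
Proof.
move=> aq bp; rewrite mulr_suml coef_sum.
transitivity (\sum_(i < a) \sum_(j < b)
  ((i == Ucoord m :> nat)%:R * ((j == Vcoord m :> nat)%:R *
     (m == Ucoord m * p + Vcoord m * q)%N%:R)) : int).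
  apply: eq_bigr => i _; rewrite mulr_sumr coef_sum; apply: eq_bigr => j _.
  rewrite -!exprM -exprD coefXn -!natrM !mulnb.
  congr (_%:R); congr (nat_of_bool _).
  apply/eqP/and3P => [e|[/eqP-> /eqP-> /eqP e]]; last first.
    by rewrite {1}e mulnC (mulnC q).
  have E : m%:Z = (i * p)%N%:Z + (j * q)%N%:Z + 0 * (p * q)%N%:Z by lia.
  rewrite (Ucoord_uniq _ E) ?(Vcoord_uniq _ E) ?eqxx; last 2 first.
  - exact: leq_trans (ltn_ord _) bp.
  - exact: leq_trans (ltn_ord _) aq.
  by split=> //; apply/eqP; lia.
under eq_bigr do rewrite -mulr_sumr -mulr_suml sum_eq_ord.
by rewrite -mulr_suml sum_eq_ord -!natrM !mulnb.
Qed.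

(** The low rectangle yields the coefficients 1. The high one, moved to the origin by passing from m
    + 1 to m, yields the coefficients -1 after the factor X. *)
Lemma binpolyE : binpoly =
  (\sum_(i < mu) ('X^p) ^+ i) * (\sum_(j < la) ('X^q) ^+ j) -
  'X * ((\sum_(i < q - mu) ('X^p) ^+ i) * (\sum_(j < p - la) ('X^q) ^+ j)).
Proof.
apply/polyP => m; rewrite coef_poly coefB coefXM.
rewrite rectangle_coef; [|lia|lia].
have uq := Ucoord_lt m; have vp := Vcoord_lt m.
have U1 := UcoordB1 m; have V1 := VcoordB1 m.
have low := @coord_low m; have high := @coord_high m.
have lowb := @lt_mulD mu la (Ucoord m) (Vcoord m).
case: m uq vp U1 V1 low high lowb => [|m] uq vp U1 V1 low high lowb /=.
  have E0 : 0%:Z = (0 * p)%N%:Z + (0 * q)%N%:Z + 0 * (p * q)%N%:Z by lia.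
  rewrite /bincoef (Ucoord_uniq _ E0) ?(Vcoord_uniq _ E0); try lia.
  have -> : (0 < p * q)%N by rewrite muln_gt0; lia.
  by case/andP: mu_bnd => -> _; case/andP: la_bnd => -> _.
rewrite rectangle_coef; [|lia|lia].
have Em : m.+1%:Z - 1 = m by lia.
rewrite Em in U1 V1; rewrite /bincoef.
have uq' := Ucoord_lt m; have vp' := Vcoord_lt m.
have highb := @lt_mulD (q - mu) (p - la) (Ucoord m) (Vcoord m).
have hm : (mu * p <= q * p)%N by rewrite leq_mul2r; lia.
have hl : (la * q <= p * q)%N by rewrite leq_mul2r; lia.
move: low high lowb highb U1 V1; rewrite !mulnBl.
case: (ltnP (Ucoord m.+1)) => hu; case: (ltnP (Vcoord m.+1)) => hv;
  move=> low high lowb highb U1 V1.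
- move/(_ isT isT): lowb => lowb.
  have -> : (Ucoord m < q - mu)%N = false by lia.
  case: ltnP => mN.
    have -> // : (m.+1 == Ucoord m.+1 * p + Vcoord m.+1 * q)%N.
    by have := low _ isT isT; lia.
  by case: eqP => //; lia.
- have -> : (Ucoord m < q - mu)%N = false by lia.
  by case: ltnP.
- have -> : (Vcoord m < p - la)%N = false by lia.
  by rewrite andbF; case: ltnP.
- have hup : (mu * p <= Ucoord m.+1 * p)%N by rewrite leq_mul2r; lia.
  have hvq : (la * q <= Vcoord m.+1 * q)%N by rewrite leq_mul2r; lia.
  have -> : (Ucoord m < q - mu)%N by lia.
  have -> : (Vcoord m < p - la)%N by lia.
  have -> : (m == Ucoord m * p + Vcoord m * q)%N = (m.+1 < p * q)%N.
    move: highb; rewrite U1 V1 !mulnBl => highb.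
    by apply/eqP/idP => [|mN]; [lia|have := high _ isT isT; lia].
  by case: ltnP.
Qed.

Lemma binpoly_identity :
  binpoly * ('X^p - 1) * ('X^q - 1) = ('X^(p * q) - 1) * ('X - 1).
Proof.
have geo (a n : nat) :
    (\sum_(i < n) ('X^a) ^+ i) * ('X^a - 1) = 'X^(n * a) - 1 :> {poly int}.
  by rewrite mulrC -subrX1 -exprM mulnC.
rewrite binpolyE.
transitivity (('X^(mu * p) - 1) * ('X^(la * q) - 1) -
  'X * (('X^((q - mu) * p) - 1) * ('X^((p - la) * q) - 1)) : {poly int}).
  by rewrite -!geo; ring.
(* By [bezout] the monomials below satisfy A B = X N, X C = B, X D = A and B D = N, which settles
   the expanded identity. *)
have e1 : 'X^(mu * p) * 'X^(la * q) = 'X * 'X^(p * q) :> {poly int}.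
  by rewrite -exprD bezout exprS.
have e2 : 'X * 'X^((q - mu) * p) = 'X^(la * q) :> {poly int}.
  by rewrite -exprS; congr ('X^_); nia.
have e3 : 'X * 'X^((p - la) * q) = 'X^(mu * p) :> {poly int}.
  by rewrite -exprS; congr ('X^_); nia.
have e4 : 'X^(la * q) * 'X^((p - la) * q) = 'X^(p * q) :> {poly int}.
  by rewrite -exprD; congr ('X^_); nia.
move: e1 e2 e3 e4; move: 'X^(mu * p) 'X^(la * q) 'X^((q - mu) * p).
move: 'X^((p - la) * q) 'X^(p * q) => D N A B C e1 e2 e3 e4.
transitivity (A * B - A - B + 1 - ('X * C) * D + 'X * C + 'X * D - 'X).
  by ring.
by rewrite e1 e2 e3 e4; ring.
Qed.

(** * Truncated coefficients and the rectangle estimate *)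

Lemma UcoordDq k y : Ucoord (y + k * q%:Z) = Ucoord y.
Proof. by rewrite /Ucoord mulrDl mulrAC addrC modzMDl. Qed.

Lemma VcoordDp k y : Vcoord (y + k * p%:Z) = Vcoord y.
Proof. by rewrite /Vcoord mulrDl mulrAC addrC modzMDl. Qed.

(** The truncated coefficient that each corner of the rectangle contributes to a difference S(x, t)
    - S(x - 1, t). *)
Definition truncoef (t : nat) (y : int) : int :=
  if (y %% (p * q)%N%:Z)%Z < t%:Z then bincoef y else 0.

Lemma coord_mod y : Ucoord (y %% (p * q)%N%:Z)%Z = Ucoord y /\
  Vcoord (y %% (p * q)%N%:Z)%Z = Vcoord y.
Proof.
have -> : (y %% (p * q)%N%:Z)%Z = y - (y %/ (p * q)%N%:Z)%Z * (p * q)%N%:Z.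
  by rewrite {2}(divz_eq y (p * q)%N%:Z) addrC addKr.
rewrite PoszM; split.
  by rewrite mulrA -mulNr UcoordDq.
by rewrite (mulrC p%:Z) mulrA -mulNr VcoordDp.
Qed.

Lemma truncoefE t y : truncoef t y =
  if (Ucoord y < mu)%N then
    if (Vcoord y < la)%N then (Ucoord y * p + Vcoord y * q < t)%N%:Z else 0
  else if (Vcoord y < la)%N then 0
  else - (Ucoord y * p + Vcoord y * q < t + p * q)%N%:Z.
Proof.
have N0 : (p * q)%N%:Z != 0 by rewrite eqz_nat muln_eq0; lia.
have m0 := modz_ge0 y N0; have mN := ltz_mod y N0.
have hm : 0 <= (y %% (p * q)%N%:Z)%Z < (p * q)%N%:Z by lia.
have := coord_low hm; have := coord_high hm; have [-> ->] := coord_mod y.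
rewrite /truncoef /bincoef; move: (y %% _)%Z => m high low.
case: ltnP high low => hu; case: ltnP => hv high low.
- by rewrite (low isT isT) -PoszD ltz_nat; case: ifP.
- by case: ifP.
- by case: ifP.
- by rewrite (high isT isT) ltrBlDr -!PoszD ltz_nat; case: ifP.
Qed.

(* When the four coefficients are equal, both diagonals of the rectangle have
   the same sum of indices, so t cannot keep one diagonal and cut the other.
   Otherwise two of them vanish and the other two contribute opposite signs. *)
Lemma truncoef_rectangle t y k l :
  `|truncoef t y - truncoef t (y + k * p%:Z) - truncoef t (y + l * q%:Z)
    + truncoef t (y + k * p%:Z + l * q%:Z)| <= 1.
Proof.
rewrite !truncoefE !UcoordDq VcoordDp.
have -> : Vcoord (y + k * p%:Z + l * q%:Z) = Vcoord (y + l * q%:Z).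
  by rewrite addrAC VcoordDp.
move: (Ucoord y) (Ucoord (y + _)) (Vcoord y) (Vcoord (y + _)) => u u' v v'.
by case: (ltnP u mu) => _; case: (ltnP u' mu) => _; case: (ltnP v la) => _;
   case: (ltnP v' la) => _; lia.
Qed.

(** * Symmetry, support and sign changes of the binary coefficients *)

Lemma bincoef0 : bincoef 0 = 1.
Proof.
have E0 : 0%:Z = (0 * p)%N%:Z + (0 * q)%N%:Z + 0 * (p * q)%N%:Z by lia.
rewrite /bincoef (Ucoord_uniq _ E0) ?(Vcoord_uniq _ E0); try lia.
Qed.

(** Since (p - 1)(q - 1) = (mu - 1) p + (la - 1) q, the reflection sends (u, v) to (mu - 1 - u, la -
    1 - v) modulo (q, p), which preserves both tests u < mu and v < la. *)
Lemma bincoef_sym y : bincoef ((p.-1 * q.-1)%N%:Z - y) = bincoef y.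
Proof.
have bz : mu%:Z * p%:Z + la%:Z * q%:Z = p%:Z * q%:Z + 1 by lia.
have ephi : (p.-1 * q.-1)%N%:Z = (p%:Z - 1) * (q%:Z - 1) by rewrite PoszM; lia.
have [k e] := coordE y; have uq := Ucoord_lt y; have vp := Vcoord_lt y.
rewrite /bincoef.
set u' := (if (Ucoord y < mu)%N then (mu - 1 - Ucoord y)%N
           else (q + mu - 1 - Ucoord y)%N).
set v' := (if (Vcoord y < la)%N then (la - 1 - Vcoord y)%N
           else (p + la - 1 - Vcoord y)%N).
have [k' E] : exists k' : int, (p.-1 * q.-1)%N%:Z - y =
  (u' * p)%N%:Z + (v' * q)%N%:Z + k' * (p * q)%N%:Z.
  exists (- k - (mu <= Ucoord y)%N%:Z - (la <= Vcoord y)%N%:Z).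
  rewrite {1}e ephi !PoszM /u' /v'.
  case: ltnP => hu; case: ltnP => hv; rewrite -!subzn ?PoszD; try lia;
  (transitivity (mu%:Z * p%:Z + la%:Z * q%:Z - p%:Z - q%:Z - k * (p%:Z * q%:Z)
     - (Ucoord y)%:Z * p%:Z - (Vcoord y)%:Z * q%:Z); [rewrite bz|]; ring).
have [uq' eu] : (u' < q)%N /\ (u' < mu)%N = (Ucoord y < mu)%N.
  by rewrite /u'; case: (ltnP (Ucoord y)) => hu; split; lia.
have [vp' ev] : (v' < p)%N /\ (v' < la)%N = (Vcoord y < la)%N.
  by rewrite /v'; case: (ltnP (Vcoord y)) => hv; split; lia.
by rewrite (Ucoord_uniq uq' E) (Vcoord_uniq vp' E) eu ev.
Qed.

(** The low rectangle ends at pq + 1 - p - q = (p - 1)(q - 1), and the high one ends just before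
    it. *)
Lemma bincoef_vanish m : (p.-1 * q.-1 < m < p * q)%N -> bincoef m%:Z = 0.
Proof.
move=> hm; have hm' : 0 <= m%:Z < (p * q)%N%:Z by lia.
have ephi : (p.-1 * q.-1)%N%:Z = (p%:Z - 1) * (q%:Z - 1) by rewrite PoszM; lia.
have low := coord_low hm'; have high := coord_high hm'.
have lowb := @lt_mulD mu la (Ucoord m) (Vcoord m).
have highb := lt_mulD (Ucoord_lt m) (Vcoord_lt m).
rewrite /bincoef.
case: ltnP low high lowb => hu; case: ltnP => hv low high lowb //.
  by have := low isT isT; have := lowb isT isT; lia.
by have := high isT isT; lia.
Qed.

Lemma bincoef_values y : bincoef y \in [:: -1; 0; 1].
Proof. by rewrite /bincoef; case: ltnP => _; case: ltnP. Qed.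

(** Equal nonzero neighbours would lie in the same rectangle, low or high; the coordinate shift from
    m + 1 to m would then make m differ from itself by pq. *)
Lemma bincoef_alternate m : (m.+1 < p * q)%N -> bincoef m%:Z != 0 ->
  bincoef m.+1%:Z != bincoef m%:Z.
Proof.
move=> mN; have hm : 0 <= m%:Z < (p * q)%N%:Z by lia.
have hm1 : 0 <= m.+1%:Z < (p * q)%N%:Z by lia.
have low := coord_low hm; have high := coord_high hm.
have low1 := coord_low hm1; have high1 := coord_high hm1.
have uq := Ucoord_lt m.+1; have vp := Vcoord_lt m.+1.
have U1 := UcoordB1 m.+1; have V1 := VcoordB1 m.+1.
have Em : m.+1%:Z - 1 = m by lia.
rewrite Em in U1 V1; rewrite /bincoef.
move: low high low1 high1 U1 V1.
have hm' : (mu * p <= q * p)%N by rewrite leq_mul2r; lia.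
have hl' : (la * q <= p * q)%N by rewrite leq_mul2r; lia.
case: (ltnP (Ucoord m.+1)) => hu; case: (ltnP (Vcoord m.+1)) => hv;
  move=> low high low1 high1 U1 V1.
- have {}low1 := low1 isT isT.
  have {}low : (Ucoord m < mu)%N -> (Vcoord m < la)%N -> False.
    move=> h1 h2; have := low h1 h2; rewrite U1 V1 !mulnBl !mulnDl; lia.
  by case: ltnP low => // _; case: ltnP => // _ /(_ isT isT).
- by case: ltnP => _; case: ltnP.
- by case: ltnP => _; case: ltnP.
- have {}high1 := high1 isT isT.
  have hup : (mu * p <= Ucoord m.+1 * p)%N by rewrite leq_mul2r; lia.
  have hvq : (la * q <= Vcoord m.+1 * q)%N by rewrite leq_mul2r; lia.
  have {}high : (mu <= Ucoord m)%N -> (la <= Vcoord m)%N -> False.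
    move=> h1 h2; have := high h1 h2; rewrite U1 V1 !mulnBl; lia.
  by case: ltnP high => // _; case: ltnP => // _ /(_ isT isT).
Qed.
End BinaryPolynomial.

(** * Exact division producing the ternary polynomial *)

(** With k r = l n + 1, y - 1 = (y^(k r) - 1) - y (y^(l n) - 1), and each difference is a geometric
    multiple. *)
Lemma sub1_coprime (R : comNzRingType) (y : R) (r n : nat) :
  (0 < r)%N -> coprime r n ->
  exists K L : R, y - 1 = (y ^+ r - 1) * K - (y ^+ n - 1) * L.
Proof.
move=> r0 /eqP crn; case: (@egcdnP r n r0) => k l; rewrite crn => e _.
exists (\sum_(i < k) (y ^+ r) ^+ i), (y * \sum_(i < l) (y ^+ n) ^+ i).
rewrite mulrCA -!subrX1 -!exprM (mulnC r) e addn1 exprS (mulnC l).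
by ring.
Qed.

Lemma ternary_quotient (p q r : nat) (P : {poly int}) :
  (0 < p)%N -> (0 < q)%N -> (0 < r)%N -> coprime r p -> coprime r q ->
  P * ('X^p - 1) * ('X^q - 1) = ('X^(p * q) - 1) * ('X - 1) ->
  exists2 A : {poly int}, A * Qden p q r = Qnum p q r &
    A * ('X^(p * q) - 1) = (P \Po 'X^r) * ((\sum_(i < p) 'X^i) * ('X^q - 1)).
Proof.
move=> p0 q0 r0 crp crq eP; set R := P \Po 'X^r; set G := _ * ('X^q - 1).
have eR : R * ('X^(r * p) - 1) * ('X^(r * q) - 1)
        = ('X^(r * (p * q)) - 1) * ('X^r - 1).
  have := congr1 (fun f => f \Po 'X^r) eP.
  by rewrite !rmorphM !rmorphB /= !comp_Xn_poly comp_polyX comp_polyC -!exprM.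
have X1 : ('X - 1 : {poly int}) != 0 by rewrite -size_poly_eq0 size_XsubC.
have eG : ('X - 1) * G = ('X^p - 1) * ('X^q - 1).
  by rewrite /G mulrA -subrX1.
set N : {poly int} := 'X^(p * q) - 1.
(* Modulo N, X^p - 1 is a multiple of X^(r p) - 1 and X^q - 1 one of X^(r q) - 1, by coprimality. By
   [eR], R times their product is then a multiple of X^(r p q) - 1, hence of N. *)
have [H eH] : exists H, R * (('X^p - 1) * ('X^q - 1)) = H * N.
  have [K1 [L1 e1]] := sub1_coprime ('X^p : {poly int}) r0 crq.
  have [K2 [L2 e2]] := sub1_coprime ('X^q : {poly int}) r0 crp.
  have [M eM] : exists M, 'X^(r * (p * q)) - 1 = N * M.
    by rewrite mulnC exprM; eexists; exact: subrX1.
  rewrite -!exprM (mulnC p r) in e1.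
  rewrite -!exprM (mulnC q r) (mulnC q p) in e2.
  rewrite -/N in e1 e2; have {}eR := etrans eR (congr1 ( *%R^~ _) eM).
  exists (M * ('X^r - 1) * K1 * K2 - R * L1 * ('X^q - 1)
          - R * ('X^(r * p) - 1) * K1 * L2).
  have e3 : ('X^p - 1) * ('X^q - 1) =
      ('X^(r * p) - 1) * K1 * (('X^(r * q) - 1) * K2 - N * L2)
      - N * L1 * ('X^q - 1) by rewrite -e2 {1}e1; ring.
  rewrite {}e3; move: eR; move: ('X^(r * p) - 1) ('X^(r * q) - 1) => a b eR.
  transitivity ((R * a * b) * K1 * K2 - R * a * K1 * N * L2
     - R * N * L1 * ('X^q - 1)); first by ring.
  by rewrite eR; ring.
set E : {poly int} := \sum_(i < p * q) 'X^i.
have eE : N = ('X - 1) * E by rewrite /E -subrX1.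
have eRG : R * G = H * E.
  by apply: (mulfI X1); rewrite mulrCA eG eH eE; ring.
(* G vanishes at 1 while E takes the value pq there, so H vanishes at 1 and supplies the missing
   factor X - 1. *)
have /factor_theorem[A eA] : root H 1.
  have := congr1 (horner^~ 1) eRG; rewrite /G !hornerM !horner_sum.
  rewrite hornerD hornerN hornerXn hornerC expr1n subrr !mulr0.
  under eq_bigr do rewrite hornerXn expr1n.
  rewrite sumr_const card_ord => /esym/eqP; rewrite mulf_eq0 => /orP[//|].
  by rewrite pnatr_eq0 muln_eq0; lia.
have eAG : A * N = R * G by rewrite eRG eA eE polyC1; ring.
exists A => //; rewrite /Qden /Qnum -/N (mulnC q r) (mulnC _ r).
transitivity ((A * N) * ('X - 1) * ('X^(r * p) - 1) * ('X^(r * q) - 1)).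
  by ring.
transitivity (R * ('X^(r * p) - 1) * ('X^(r * q) - 1) * (('X - 1) * G)).
  by rewrite eAG; ring.
by rewrite eR eG; ring.
Qed.

(** Coefficients of (1 + ... + z^(p-1)) (1 - z^q) = (1 - z^pq) / Q_pq(z): one period of the
    expansion of 1 / Q_pq. *)
Definition window (p q : nat) (k : nat) : int :=
  (k < p)%N%:R - (q <= k < q + p)%N%:R.

Lemma coef_window p q k :
  ((\sum_(i < p) 'X^i) * ('X^q - 1) : {poly int})`_k = - window p q k.
Proof.
have c k' : (\sum_(i < p) 'X^i : {poly int})`_k' = (k' < p)%N%:R.
  rewrite coef_sum; under eq_bigr do rewrite coefXn eq_sym.
  by rewrite sum_eq_ord.
rewrite mulrBr mulr1 coefB coefMXn !c /window opprB; congr (_ - _).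
by case: ltnP => //= h; congr (_%:R); congr (nat_of_bool _); lia.
Qed.

Lemma monic_Qden p q r : (0 < p)%N -> (0 < q)%N -> (0 < r)%N ->
  Qden p q r \is monic.
Proof.
move=> p0 q0 r0.
rewrite /Qden !monicMl ?monic_Xn_sub_1 ?muln_gt0 ?p0 ?q0 ?r0 //.
by rewrite -polyC1 monicXsubC.
Qed.

Lemma size_ternary_quotient p q r (A : {poly int}) :
  (0 < p)%N -> (0 < q)%N -> (0 < r)%N ->
  A * Qden p q r = Qnum p q r -> size A = (phi p q r).+1.
Proof.
move=> p0 q0 r0 eA.
have sz n : (0 < n)%N -> size ('X^n - 1 : {poly int}) = n.+1.
  by move=> n0; rewrite -polyC1 size_XnsubC.
have szM (B : {poly int}) n : (0 < n)%N -> B != 0 ->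
    size (B * ('X^n - 1)) = (size B + n)%N.
  by move=> n0 B0; rewrite size_Mmonic ?monic_Xn_sub_1 // sz // addnS.
have nzM (B : {poly int}) n : (0 < n)%N -> B != 0 -> B * ('X^n - 1) != 0.
  by move=> n0 B0; rewrite mulf_neq0 // monic_neq0 ?monic_Xn_sub_1.
have nz n : (0 < n)%N -> ('X^n - 1 : {poly int}) != 0.
  by move=> n0; rewrite monic_neq0 ?monic_Xn_sub_1.
have pqr0 : (0 < p * q * r)%N by rewrite !muln_gt0 p0 q0 r0.
have szn : size (Qnum p q r) = (p * q * r + p + q + r).+1.
  by rewrite /Qnum !szM ?sz ?nzM ?nz //; lia.
have A0 : A != 0.
  by apply: contraTneq isT => A0; move: szn; rewrite -eA A0 mul0r size_poly0.
have szd : size (Qden p q r) = (q * r + r * p + p * q + 1).+1.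
  rewrite /Qden -{4}(expr1 'X) !szM ?sz ?nzM ?nz ?muln_gt0 ?p0 ?q0 ?r0 //; lia.
have := size_Mmonic A0 (monic_Qden p0 q0 r0); rewrite eA szn szd /phi.
case: p q r p0 q0 r0 {eA szn szd pqr0} => [|p] [|q] [|r] //= _ _ _; lia.
Qed.

Lemma sum_ord_support (F : nat -> int) (a b : nat) :
  (forall m, (a <= m)%N -> F m = 0) -> (forall m, (b <= m)%N -> F m = 0) ->
  \sum_(m < a) F m = \sum_(m < b) F m.
Proof.
wlog le_ab : a b / (a <= b)%N => [hw Fa Fb|Fa _].
  by case: (leqP a b) => [/hw|/ltnW/hw h]; [apply|rewrite h].
rewrite (big_ord_widen _ F le_ab) big_mkcond /=; apply: eq_bigr => m _.
by case: ltnP => // /Fa.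
Qed.

Lemma addn_lt_muln (p q : nat) : (2 < p)%N -> (2 < q)%N -> (p + q < p * q)%N.
Proof. by move=> hp hq; nia. Qed.

(** * Coefficients as partial sums S(x, t) *)

Section PartialSums.

Variables p q mu la : nat.
Hypotheses (p_gt2 : (2 < p)%N) (q_gt2 : (2 < q)%N).
Hypotheses (mu_bnd : (0 < mu < q)%N) (la_bnd : (0 < la < p)%N).
Hypothesis bezout : (mu * p + la * q = (p * q).+1)%N.

Let P := binpoly p q mu la.
Let c (y : int) := bincoef p q mu la y.

Definition chi (z : int) : int := window p q `|(z %% (p * q)%N%:Z)%Z|%N.

(** This is S(x, t); r ranges over all integers so that -r is allowed. *)
Definition psum (r x : int) (t : nat) : int :=
  \sum_(m < t) (binpoly p q mu la)`_m * chi (x - r * m%:Z).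

Lemma psumS r x t : psum r x t.+1 = psum r x t + P`_t * chi (x - r * t%:Z).
Proof. by rewrite /psum big_ord_recr. Qed.

Lemma chi_eqmod z z' : (z = z' %[mod (p * q)%N%:Z])%Z -> chi z = chi z'.
Proof. by rewrite /chi => ->. Qed.

Lemma chi_nat (k : nat) : (k < p * q)%N -> chi k%:Z = window p q k.
Proof. by move=> kN; rewrite /chi modz_small //; lia. Qed.

Lemma chiD z k : chi (k * (p * q)%N%:Z + z) = chi z.
Proof. by rewrite /chi modzMDl. Qed.

Lemma psum_eqmod r r' x x' t :
  (r = r' %[mod (p * q)%N%:Z])%Z -> (x = x' %[mod (p * q)%N%:Z])%Z ->
  psum r x t = psum r' x' t.
Proof.
move=> /eqP er /eqP ex; apply: eq_bigr => m _; congr (_ * _).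
apply/chi_eqmod/eqP; move: er ex; rewrite !eqz_mod_dvd => er ex.
have -> : x - r * m%:Z - (x' - r' * m%:Z) = x - x' - (r - r') * m%:Z by ring.
by rewrite rpredB // dvdz_mulr.
Qed.

Lemma coef_binpoly m : P`_m = if (m < p * q)%N then c m%:Z else 0.
Proof. by rewrite coef_poly. Qed.

Lemma coef_binpoly_vanish m : (p.-1 * q.-1 < m)%N -> P`_m = 0.
Proof.
move=> hm; rewrite coef_binpoly; case: ltnP => // mN.
by apply: bincoef_vanish; rewrite ?hm.
Qed.

(** Comparing coefficients expresses A_n as A_(n - pq) plus the sum of c_m [window](n - r m);
    induction on n adds up the periods. Each term has a single source: [window] if n - r m < pq,
    otherwise A_(n - pq), as [window] vanishes from p + q < pq on. *)
Lemma psum_coef (r : nat) (A : {poly int}) : (0 < r)%N ->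
  A * ('X^(p * q) - 1) = (P \Po 'X^r) * ((\sum_(i < p) 'X^i) * ('X^q - 1)) ->
  forall n : nat, A`_n = psum r%:Z n%:Z (n %/ r).+1.
Proof.
move=> r0 eA; have hN := addn_lt_muln p_gt2 q_gt2.
have rec n : A`_n = (if (n < p * q)%N then 0 else A`_(n - p * q)) +
    \sum_(m < (n %/ r).+1) P`_m * window p q (n - r * m)%N.
  have := congr1 (fun f : {poly int} => f`_n) eA.
  rewrite /= mulrBr mulr1 coefB coefMXn => /eqP.
  rewrite subr_eq addrC -subr_eq eq_sym => /eqP->; congr (_ + _).
  rewrite comp_polyE mulr_suml coef_sum -sumrN.
  pose F m : int := if (n < r * m)%N then 0
    else P`_m * window p q (n - r * m)%N.
  transitivity (\sum_(m < size P) F m).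
    apply: eq_bigr => m _.
    rewrite -scalerAl coefZ -exprM coefXnM coef_window /F.
    by case: ifP => _; rewrite ?mulr0 ?oppr0 // mulrN opprK.
  rewrite (@sum_ord_support F _ (n %/ r).+1); first last.
  - by move=> m; rewrite -ltnS ltnS ltn_divLR // mulnC /F => ->.
  - by move=> m hm; rewrite /F nth_default // mul0r if_same.
  apply: eq_bigr => m _; rewrite /F ifN // -leqNgt mulnC -leq_divRL //.
  by rewrite -ltnS.
elim/ltn_ind => n IH; rewrite {}rec /psum.
have -> : (if (n < p * q)%N then 0 else A`_(n - p * q)) =
   \sum_(m < (n %/ r).+1) (if (n < p * q + r * m)%N then 0
      else P`_m * chi ((n - p * q)%N%:Z - r%:Z * m%:Z)).
  case: ltnP => hn.
    by rewrite big1 // => m _; rewrite ifT //; lia.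
  rewrite IH; last by lia.
  pose F m : int := if (n < p * q + r * m)%N then 0
      else P`_m * chi ((n - p * q)%N%:Z - r%:Z * m%:Z).
  rewrite -/(\sum_(m < (n %/ r).+1) F m).
  rewrite (@sum_ord_support F _ ((n - p * q) %/ r).+1).
  - apply: eq_bigr => m _; rewrite /F ifN // -leqNgt -leq_subRL // mulnC.
    by rewrite -leq_divRL // -ltnS.
  - move=> m; rewrite -ltnS ltnS ltn_divLR // mulnC /F => h.
    by rewrite ifT //; lia.
  - move=> m; rewrite -ltnS ltnS ltn_divLR // mulnC /F => h.
    by rewrite ifT //; lia.
rewrite -big_split; apply: eq_bigr => m _ /=.
have hm : (r * m <= n)%N by rewrite mulnC -leq_divRL // -ltnS.
have -> : n%:Z - r%:Z * m%:Z = (n - r * m)%N%:Z by lia.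
case: ltnP => h; first by rewrite add0r chi_nat //; lia.
have -> : (n - p * q)%N%:Z - r%:Z * m%:Z =
    (-1) * (p * q)%N%:Z + (n - r * m)%N%:Z by lia.
rewrite chiD -mulrDr; congr (_ * _); rewrite /window.
have -> : ((n - r * m)%N < p)%N = false by lia.
have -> : (q <= (n - r * m)%N < q + p)%N = false by lia.
by rewrite subrr addr0.
Qed.

Lemma psum_stable r x t t' : (p.-1 * q.-1 < t)%N -> (p.-1 * q.-1 < t')%N ->
  psum r x t = psum r x t'.
Proof.
move=> ht ht'.
apply: (@sum_ord_support (fun m => P`_m * chi (x - r * m%:Z))) => m h.
- by rewrite coef_binpoly_vanish ?mul0r //; lia.
- by rewrite coef_binpoly_vanish ?mul0r //; lia.
Qed.

Lemma psum_vanish (r : nat) x t :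
  (0 < r)%N -> coprime r p -> coprime r q ->
  (p.-1 * q.-1 < t)%N -> psum r%:Z x t = 0.
Proof.
move=> r0 crp crq ht; have hN := addn_lt_muln p_gt2 q_gt2.
have N0 : (p * q)%N%:Z != 0 by lia.
have [p0 q0] : (0 < p)%N /\ (0 < q)%N by lia.
have [A _ eA] := ternary_quotient p0 q0 r0 crp crq
  (binpoly_identity p_gt2 q_gt2 mu_bnd la_bnd bezout).
(* This n is congruent to x, exceeds the degree of A, and has n / r >= pq, so that the zero
   coefficient A_n is a complete sum. *)
pose n := (`|(x %% (p * q)%N%:Z)%Z| + (size A + r * (p * q)) * (p * q))%N.
have hn : (size A + r * (p * q) <= n)%N.
  by apply: leq_trans (leq_addl _ _); apply: leq_pmulr; lia.
have eA0 : A`_n = 0 by apply/nth_default/leq_trans/hn/leq_addr.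
move: eA0; rewrite (psum_coef r0 eA) => <-.
rewrite (psum_stable _ _ ht (t' := (n %/ r).+1)).
  apply: psum_eqmod => //; rewrite /n PoszD (PoszM _ (p * q)) addrC modzMDl.
  by rewrite gez0_abs ?modz_ge0 // modz_mod.
have : (p * q <= n %/ r)%N.
  by rewrite leq_divRL // mulnC; apply: leq_trans hn; apply: leq_addl.
have : (p.-1 * q.-1 <= p * q)%N by apply: leq_mul; lia.
lia.
Qed.

Lemma coef_binpoly_sym m : (m <= p.-1 * q.-1)%N ->
  P`_(p.-1 * q.-1 - m) = P`_m.
Proof.
move=> hm; have h : (p.-1 * q.-1 < p * q)%N.
  by have := leq_mul (leq_pred p) (leqnn q.-1); have : (p * q.-1 < p * q)%N;
     rewrite ?ltn_mul2l; lia.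
rewrite !coef_binpoly !ifT; try lia.
by rewrite -subzn // /c bincoef_sym.
Qed.

(** Under m -> (p - 1)(q - 1) - m, adding the term t on the left removes the matching term on the
    right, as c is palindromic. The induction starts from the vanishing complete sum. *)
Lemma psum_reflect (r : nat) x t :
  (0 < r)%N -> coprime r p -> coprime r q -> (t <= (p.-1 * q.-1).+1)%N ->
  psum (- r%:Z) x t =
  - psum r%:Z (x + r%:Z * (p.-1 * q.-1)%N%:Z) ((p.-1 * q.-1).+1 - t).
Proof.
move=> r0 crp crq; elim: t => [|t IH] ht.
  by rewrite subn0 psum_vanish // /psum big_ord0 oppr0.
rewrite psumS IH; last exact: ltnW.
have -> : ((p.-1 * q.-1).+1 - t = (p.-1 * q.-1 - t).+1)%N by lia.
rewrite psumS coef_binpoly_sym // subSS -subzn //.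
set a := chi _; set b := chi _; have -> : a = b by congr chi; ring.
by ring.
Qed.
End PartialSums.

(** * Discrete intermediate values and jumps of size at most 1 *)

Lemma intermediate_value (f : nat -> int) (i j : nat) (a : int) :
  (forall m, `|f m.+1 - f m| <= 1) -> f i <= a <= f j ->
  exists2 k, (k <= maxn i j)%N & f k = a.
Proof.
have up (g : nat -> int) b n d : (forall m, `|g m.+1 - g m| <= 1) ->
    g n <= b <= g (n + d)%N -> exists2 k, (k <= n + d)%N & g k = b.
  move=> jump; elim: d => [|d IH] hb.
    by exists n; rewrite addn0 in hb *; lia.
  have [le|lt] := leP b (g (n + d)%N).
    have [|k hk e] := IH; first by lia.
    by exists k => //; lia.
  exists (n + d.+1)%N => //; have := jump (n + d)%N; rewrite addnS in hb *; lia.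
move=> jump ha; case: (leqP i j) => [le_ij|/ltnW le_ji].
  have [||k hk e] := up f a i (j - i)%N; rewrite ?subnKC //.
  by exists k; rewrite // -(subnKC le_ij).
have [||k hk /oppr_inj e] := up (fun m => - f m) (- a) j (i - j)%N.
- by move=> m; have := jump m; lia.
- by rewrite subnKC //; lia.
by exists k => //; lia.
Qed.

Lemma modz_natE (N : nat) (z : int) : (0 < N)%N ->
  exists k : int, exists2 i : nat, z = k * N%:Z + i%:Z & (i < N)%N.
Proof.
move=> N_gt0; have N0 : N%:Z != 0 by lia.
exists (z %/ N%:Z)%Z, `|(z %% N%:Z)%Z|%N.
  by rewrite gez0_abs ?modz_ge0 //; exact: divz_eq.
by have := ltz_mod z N0; have := modz_ge0 z N0; lia.
Qed.

Lemma dvdz_small (N : nat) (k : int) (i a : nat) : (i < N)%N -> (a < N)%N ->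
  (N%:Z %| k * N%:Z + i%:Z - a%:Z)%Z = (i == a).
Proof.
by move=> hi ha; rewrite -eqz_mod_dvd modzMDl !modz_small //; lia.
Qed.

Section Jumps.

Variables p q mu la : nat.
Hypotheses (p_gt2 : (2 < p)%N) (q_gt2 : (2 < q)%N).
Hypotheses (mu_bnd : (0 < mu < q)%N) (la_bnd : (0 < la < p)%N).
Hypothesis bezout : (mu * p + la * q = (p * q).+1)%N.

Let P := binpoly p q mu la.
Let N_gt := addn_lt_muln p_gt2 q_gt2.

(** The window rises at 0 and p + q and falls at p and q; since p + q < pq, all four points lie in
    one period. *)
Lemma chi_jump z : chi p q z - chi p q (z - 1) =
  ((p * q)%N%:Z %| z)%Z%:R - ((p * q)%N%:Z %| z - p%:Z)%Z%:R
  - ((p * q)%N%:Z %| z - q%:Z)%Z%:R + ((p * q)%N%:Z %| z - (p + q)%N%:Z)%Z%:R.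
Proof.
have [k [i -> hi]] := modz_natE z (leq_ltn_trans (leq0n _) N_gt).
rewrite -[X in (_ %| X)%Z%:R - _ - _]subr0.
rewrite !dvdz_small //; try lia.
rewrite chiD chi_nat //.
case: i hi => [|i] hi.
  have -> : k * (p * q)%N%:Z + 0%N%:Z - 1 =
      (k - 1) * (p * q)%N%:Z + (p * q).-1%:Z by lia.
  by rewrite chiD chi_nat /window; lia.
have -> : k * (p * q)%N%:Z + i.+1%:Z - 1 = k * (p * q)%N%:Z + i%:Z by lia.
rewrite chiD chi_nat /window; lia.
Qed.

(** As r' inverts r modulo pq, the divisibility singles out the index m congruent to r' y, and the
    sum keeps it only if it is below t. *)
Lemma sum_coef_dvd (r r' y : int) (t : nat) :
  ((p * q)%N%:Z %| r' * r - 1)%Z ->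
  \sum_(m < t) P`_m * ((p * q)%N%:Z %| y - r * m%:Z)%Z%:R
  = truncoef p q mu la t (r' * y).
Proof.
move=> hr; have N0 : (p * q)%N%:Z != 0 by lia.
have [k [s es hs]] := modz_natE (r' * y) (leq_ltn_trans (leq0n _) N_gt).
have dvdE m : (m < p * q)%N -> ((p * q)%N%:Z %| y - r * m%:Z)%Z = (m == s).
  move=> hm; rewrite eq_sym -(dvdz_small k hs hm) -es.
  apply/idP/idP => h.
    have -> : r' * y - m%:Z = r' * (y - r * m%:Z) + (r' * r - 1) * m%:Z by ring.
    by apply: rpredD; [exact: dvdz_mull|exact: dvdz_mulr].
  have -> : y - r * m%:Z = r * (r' * y - m%:Z) - (r' * r - 1) * y by ring.
  by apply: rpredB; [exact: dvdz_mull|exact: dvdz_mulr].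
transitivity (\sum_(m < t) P`_s * (m == s :> nat)%:R).
  apply: eq_bigr => m _; rewrite /P coef_binpoly.
  case: ltnP => hm.
    by rewrite dvdE //; case: eqP => [->|]; rewrite ?mulr0 // coef_binpoly hs.
  by rewrite mul0r; case: eqP hm => [->|]; rewrite ?mulr0 //; lia.
rewrite -mulr_sumr sum_eq_ord /truncoef es modzMDl modz_small; last by lia.
rewrite ltz_nat /P coef_binpoly hs; case: ltnP => _; rewrite ?mulr0 // mulr1.
have [U V] := coord_mod p q mu la (k * (p * q)%N%:Z + s%:Z).
by rewrite /bincoef -U -V modzMDl modz_small //; lia.
Qed.

Lemma psum_jump (r : nat) x t : coprime r p -> coprime r q ->
  `|psum p q mu la r%:Z x t - psum p q mu la r%:Z (x - 1) t| <= 1.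
Proof.
move=> crp crq; have : coprimez r%:Z (p * q)%N%:Z.
  by rewrite coprimezE !absz_nat coprimeMr crp.
case/coprimezP => [[r' v] /= e].
have hr : ((p * q)%N%:Z %| r' * r%:Z - 1)%Z.
  by apply/dvdzP; exists (- v); lia.
(* The four jump points of [chi] become the corners r' x, r' (x - p), r' (x - q) and r' (x - p -
   q). *)
have := truncoef_rectangle p_gt2 q_gt2 mu_bnd la_bnd bezout t
  (r' * x) (- r') (- r').
rewrite (_ : r' * x + - r' * p%:Z = r' * (x - p%:Z)); last by ring.
rewrite (_ : r' * x + - r' * q%:Z = r' * (x - q%:Z)); last by ring.
rewrite (_ : r' * (x - p%:Z) + - r' * q%:Z = r' * (x - (p + q)%N%:Z));
  last by rewrite PoszD; ring.
rewrite -!(sum_coef_dvd _ _ hr) -!sumrB -big_split /psum.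
congr (`| _ | <= 1); apply: eq_bigr => m _ /=.
have -> : x - 1 - r%:Z * m%:Z = x - r%:Z * m%:Z - 1 by ring.
have swap a : x - a - r%:Z * m%:Z = x - r%:Z * m%:Z - a by ring.
rewrite -[RHS]mulrBr chi_jump (swap p) (swap q) (swap (p + q)%N) -/P; ring.
Qed.

Lemma coef_jump (r : nat) (A : {poly int}) n : (0 < r)%N ->
  coprime r p -> coprime r q ->
  (forall n : nat, A`_n = psum p q mu la r%:Z n%:Z (n %/ r).+1) ->
  `|A`_n.+1 - A`_n| <= 1.
Proof.
move=> r0 crp crq eA; rewrite !eA.
have := psum_jump n.+1 (n.+1 %/ r).+1 crp crq.
have -> : n.+1%:Z - 1 = n by lia.
rewrite div.divnS //; case: (boolP (r %| n.+1)%N) => [/dvdnP[d ed]|_];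
  last by rewrite add0n.
have -> : (n %/ r = d.-1)%N.
  have := div.divnS n r0; rewrite ed mulnK // dvdn_mull //; lia.
rewrite add1n prednK; last by case: d ed.
(* When r d = n + 1, the sum for n + 1 has one more term than the sum for n. At n that term carries
   chi(-1) = 0, so both sums may be taken with the same length. *)
rewrite [psum _ _ _ _ _ n _ in X in X -> _]psumS.
have -> : n%:Z - r%:Z * d%:Z = (-1) * (p * q)%N%:Z + (p * q).-1%:Z by lia.
rewrite chiD chi_nat; last by lia.
have -> : window p q (p * q).-1 = 0 by rewrite /window; lia.
by rewrite mulr0 addr0.
Qed.

End Jumps.

(** * Partial sums lie between the extreme coefficients *)

Section Range.

Variables p q mu la : nat.
Hypotheses (p_gt2 : (2 < p)%N) (q_gt2 : (2 < q)%N).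
Hypotheses (mu_bnd : (0 < mu < q)%N) (la_bnd : (0 < la < p)%N).
Hypothesis bezout : (mu * p + la * q = (p * q).+1)%N.

Let P := binpoly p q mu la.
Let N_gt := addn_lt_muln p_gt2 q_gt2.

Lemma coef_binpoly_values m : P`_m \in [:: -1; 0; 1].
Proof.
by rewrite /P coef_binpoly; case: ifP => // _; apply: bincoef_values.
Qed.

Lemma coef_binpoly_alternate m : P`_m != 0 -> P`_m.+1 != P`_m.
Proof.
rewrite /P !coef_binpoly; case: (ltnP m.+1) => h.
  by rewrite ifT; [apply: bincoef_alternate|lia].
by rewrite eq_sym.
Qed.

(** The sign [eps] treats maximum and minimum together, and 0 <= b covers the empty sum. *)
Lemma psum_bound (r : nat) (a : nat -> int) (eps b x : int) t :
  (maxn p q < r)%N ->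
  (forall n : nat, a n = psum p q mu la r%:Z n%:Z (n %/ r).+1) ->
  `|eps| = 1 -> 0 <= b -> (forall n, eps * a n <= b) ->
  eps * psum p q mu la r%:Z x t <= b.
Proof.
move=> rmax ea eps1 b0 hb; elim: t => [|t IH].
  by rewrite /psum big_ord0 mulr0.
have [k [i ei hi]] := modz_natE (x - r%:Z * t%:Z)
  (leq_ltn_trans (leq0n _) N_gt).
have echi : chi p q (x - r%:Z * t%:Z) = window p q i by rewrite ei chiD chi_nat.
have [neg|pos] := leP (eps * (P`_t * window p q i)) 0.
  by rewrite psumS mulrDr echi -/P; lia.
pose n := (r * t + i)%N.
have ex u : psum p q mu la r%:Z x u = psum p q mu la r%:Z n%:Z u.
  apply: psum_eqmod => //.
  have -> : x = k * (p * q)%N%:Z + n%:Z by rewrite /n; lia.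
  by rewrite modzMDl.
have r0 : (0 < r)%N by lia.
have [ir|ri] := ltnP i r.
  have := hb n; rewrite ea ex (_ : (n %/ r = t)%N) //.
  by rewrite /n mulnC divnMDl // divn_small ?addn0.
have := coef_binpoly_values t; have := coef_binpoly_values t.+1.
have := @coef_binpoly_alternate t.
(* A nonzero window value forces i < p + q < 2 r, so exactly one further term enters. *)
have en : (n %/ r = t.+1)%N.
  rewrite /n -(subnKC ri) addnA -mulnSr mulnC divnMDl // divn_small ?addn0 //.
  by move: pos; rewrite /window; lia.
have := hb n; rewrite ea en [psum _ _ _ _ _ _ t.+2]psumS -ex.
have -> : n%:Z - r%:Z * t.+1%:Z = (i - r)%N%:Z by rewrite /n; lia.
rewrite chi_nat; last by lia.
move: pos; rewrite -/P /window; move: (psum _ _ _ _ _ _ _) => s.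
rewrite !inE; move: P`_t P`_t.+1 => c0 c1.
have -> : (i < p)%N = false by lia.
(* Here the window is -1 at i, so c_t = -[eps] and [eps] c_(t+1) >= 0; at i - r, below both p and q,
   it is 1. *)
case: ltnP => hiq; last by rewrite andbF subrr !mulr0.
have -> : ((i - r)%N < p)%N by lia.
have -> : (q <= (i - r)%N < q + p)%N = false by lia.
have -> : (q <= i)%N by lia.
have [->|->] : eps = 1 \/ eps = -1 by lia.
  by move=> /= *; lia.
by move=> /= *; lia.
Qed.

End Range.

(** * Coefficient sets as intervals and as value sets of S *)

Lemma Qpoly_quotient p q r (A : {poly int}) :
  (0 < p)%N -> (0 < q)%N -> (0 < r)%N ->
  A * Qden p q r = Qnum p q r -> Qpoly p q r = A.
Proof.
by move=> p0 q0 r0 eA; rewrite /Qpoly -eA Pdiv.IdomainMonic.mulpK ?monic_Qden.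
Qed.

Lemma coef_set_interval p q r :
  (forall n, `|(Qpoly p q r)`_n.+1 - (Qpoly p q r)`_n| <= 1) ->
  coef_set p q r = [set a : int | Aminus p q r <= a <= Aplus p q r].
Proof.
move=> jump; set f := fun n => (Qpoly p q r)`_n.
(* The extremes are attained: the neutral value of the iterated minimum or maximum is the
   coefficient at 0. *)
have [i hi ei] : exists2 i, (i <= phi p q r)%N & f i = Aminus p q r.
  apply: (big_ind (fun v => exists2 i, (i <= phi p q r)%N & f i = v)).
  - by exists 0%N.
  - by move=> u v hu hv; case: (leP u v).
  - by move=> m _; exists m => //; exact: leq_ord.
have [j hj ej] : exists2 j, (j <= phi p q r)%N & f j = Aplus p q r.
  apply: (big_ind (fun v => exists2 i, (i <= phi p q r)%N & f i = v)).
  - by exists 0%N.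
  - by move=> u v hu hv; case: (leP u v).
  - by move=> m _; exists m => //; exact: leq_ord.
apply/seteqP; split => [_ [m hm <-]|a] /=.
  have {}hm : (m < (phi p q r).+1)%N := hm; apply/andP; split.
    exact: (bigmin_le _ (Ordinal hm) (fun k : 'I__ => f k)).
  exact: (le_bigmax _ (fun k : 'I__ => f k) (Ordinal hm)).
rewrite -ei -ej => ha; have [k hk <-] := intermediate_value jump ha.
by exists k => //=; rewrite (leq_trans hk) // geq_max hi hj.
Qed.

Section Ternary.

Variables p q mu la : nat.
Hypotheses (p_gt2 : (2 < p)%N) (q_gt2 : (2 < q)%N).
Hypotheses (mu_bnd : (0 < mu < q)%N) (la_bnd : (0 < la < p)%N).
Hypothesis bezout : (mu * p + la * q = (p * q).+1)%N.

Let p_gt0 : (0 < p)%N := ltn_trans (isT : (0 < 2)%N) p_gt2.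
Let q_gt0 : (0 < q)%N := ltn_trans (isT : (0 < 2)%N) q_gt2.

Lemma Qpoly_facts r : (0 < r)%N -> coprime r p -> coprime r q ->
  [/\ Qpoly p q r * Qden p q r = Qnum p q r,
      size (Qpoly p q r) = (phi p q r).+1
    & forall n, (Qpoly p q r)`_n = psum p q mu la r%:Z n%:Z (n %/ r).+1].
Proof.
move=> r0 crp crq; have [A eQ eA] := ternary_quotient p_gt0 q_gt0 r0 crp crq
  (binpoly_identity p_gt2 q_gt2 mu_bnd la_bnd bezout).
rewrite (Qpoly_quotient _ _ _ eQ) //; split => //.
- exact: size_ternary_quotient eQ.
- exact: psum_coef eA.
Qed.

Lemma Qpoly_jump r n : (0 < r)%N -> coprime r p -> coprime r q ->
  `|(Qpoly p q r)`_n.+1 - (Qpoly p q r)`_n| <= 1.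
Proof.
move=> r0 crp crq; have [_ _ eA] := Qpoly_facts r0 crp crq.
exact: coef_jump p_gt2 q_gt2 mu_bnd la_bnd bezout _ _ _ r0 crp crq eA.
Qed.

Lemma coef_set_psum r : (maxn p q < r)%N -> coprime r p -> coprime r q ->
  coef_set p q r =
  [set a | exists x t, a = psum p q mu la r%:Z x t].
Proof.
move=> hr crp crq; have r0 : (0 < r)%N by lia.
have [_ szQ eQ] := Qpoly_facts r0 crp crq.
apply/seteqP; split => [_ [m hm <-]|_ [x [t ->]]].
  by exists m%:Z, (m %/ r).+1; rewrite eQ.
have c0 : (binpoly p q mu la)`_0 = 1.
  by rewrite coef_binpoly bincoef0 // muln_gt0 p_gt0 q_gt0.
(* Only c_0 = 1 enters here. The resulting values 1 at 0 and -1 at max(p, q) give [Aminus] < 0 <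
   [Aplus], so zero coefficients past the degree also stay in range and the bounds in [psum_bound]
   are nonnegative. *)
have small n : (n < r)%N -> (n < p * q)%N -> (Qpoly p q r)`_n = window p q n.
  move=> nr nN; rewrite eQ divn_small // psumS /psum big_ord0 add0r c0 mul1r.
  by rewrite mulr0 subr0 chi_nat.
have hN := addn_lt_muln p_gt2 q_gt2.
have Q0 : (Qpoly p q r)`_0 = 1 by rewrite small /window; lia.
have Qmax : (Qpoly p q r)`_(maxn p q) = -1.
  by rewrite small /window; lia.
have within n : Aminus p q r <= (Qpoly p q r)`_n <= Aplus p q r.
  have inr m : (Qpoly p q r)`_m != 0 ->
      Aminus p q r <= (Qpoly p q r)`_m <= Aplus p q r.
    move=> nz; suff : coef_set p q r (Qpoly p q r)`_m.
      by rewrite coef_set_interval => // k; apply: Qpoly_jump.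
    exists m => //=; rewrite -ltnS -szQ ltnNge; apply: contraNN nz => h.
    by rewrite nth_default.
  have [e|/inr//] := eqVneq (Qpoly p q r)`_n 0.
  by have := inr 0%N; have := inr (maxn p q); rewrite Q0 Qmax e; lia.
rewrite coef_set_interval; last by move=> k; apply: Qpoly_jump.
have A0 := within 0%N; rewrite Q0 in A0.
have Am := within (maxn p q); rewrite Qmax in Am.
have bound := @psum_bound p q mu la p_gt2 q_gt2 mu_bnd la_bnd bezout
  r _ _ _ x t hr eQ.
apply/andP; split.
  have := bound (-1) (- Aminus p q r) erefl; rewrite !mulN1r lerN2.
  apply; first by lia.
  by move=> n; rewrite mulN1r lerN2; case/andP: (within n).
rewrite -[leLHS]mul1r; apply: bound => //; first by lia.
by move=> n; rewrite mul1r; case/andP: (within n).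
Qed.

Lemma coef_set_congr r s : (maxn p q < r)%N -> (maxn p q < s)%N ->
  coprime r p -> coprime r q -> coprime s p -> coprime s q ->
  (r%:Z = s%:Z %[mod (p * q)%:Z])%Z -> coef_set p q r = coef_set p q s.
Proof.
move=> hr hs crp crq csp csq e; rewrite !coef_set_psum //.
by apply/seteqP; split => _ [x [t ->]]; exists x, t; apply: psum_eqmod.
Qed.

Lemma coef_set_opp r s : (maxn p q < r)%N -> (maxn p q < s)%N ->
  coprime r p -> coprime r q -> coprime s p -> coprime s q ->
  (r%:Z = - s%:Z %[mod (p * q)%:Z])%Z ->
  coef_set p q r = [set - a | a in coef_set p q s].
Proof.
move=> hr hs crp crq csp csq e; rewrite !coef_set_psum //.
have opp u x t : (0 < u)%N -> coprime u p -> coprime u q -> exists x' t',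
    psum p q mu la (- u%:Z) x t = - psum p q mu la u%:Z x' t'.
  move=> u0 cup cuq; have [ht|ht] := leqP t (p.-1 * q.-1).+1.
    by eexists; eexists; apply: psum_reflect => //.
  (* Beyond the degree of Q_pq the sum is constant in t, so t is lowered to the range of the
     reflection. *)
  rewrite (psum_stable _ _ _ _ _ _ _ (t' := (p.-1 * q.-1).+1)) //;
    last exact: ltnW.
  by eexists; eexists; apply: psum_reflect => //.
have e' : (s%:Z = - r%:Z %[mod (p * q)%:Z])%Z.
  by apply/eqP; move/eqP: e; rewrite !eqz_mod_dvd !opprK addrC.
apply/seteqP; split => [_ [x [t ->]]|_ [_ [x [t ->]] <-]] /=.
  have [|x' [t' E]] := opp s x t _ csp csq; first by lia.
  exists (psum p q mu la s%:Z x' t'); first by exists x', t'.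
  by rewrite -E; apply: psum_eqmod.
have [|x' [t' E]] := opp r x t _ crp crq; first by lia.
exists x', t'; rewrite -[RHS]opprK -E; congr (- _); exact: psum_eqmod.
Qed.
End Ternary.

Theorem theorem3 (p q r : nat)
    (hp : (3 <= p)%N) (hq : (3 <= q)%N) (hr : (3 <= r)%N)
    (cpq : coprime p q) (cqr : coprime q r) (crp : coprime r p) :
  [/\ Qpoly p q r * Qden p q r = Qnum p q r,
      size (Qpoly p q r) = (phi p q r).+1,
      coef_set p q r = [set a : int | Aminus p q r <= a <= Aplus p q r]
    & forall s : nat, coprime q s -> coprime s p ->
      (maxn p q < r)%N -> (maxn p q < s)%N ->
        ((r%:Z = s%:Z %[mod (p * q)%:Z])%Z ->
           coef_set p q r = coef_set p q s)
     /\ ((r%:Z = - s%:Z %[mod (p * q)%:Z])%Z ->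
           coef_set p q r = [set - a | a in coef_set p q s])].
Proof.
have [mu [la [mu_bnd la_bnd bezout]]] := bezout_pos (ltnW hp) (ltnW hq) cpq.
have r0 : (0 < r)%N by apply: leq_trans hr.
have crq : coprime r q by rewrite coprime_sym.
have [eQ szQ _] := Qpoly_facts hp hq mu_bnd la_bnd bezout r0 crp crq.
split => //.
  apply: coef_set_interval => n.
  exact: (Qpoly_jump hp hq mu_bnd la_bnd bezout).
move=> s cqs csp ltr lts; have csq : coprime s q by rewrite coprime_sym.
split; first exact: (coef_set_congr hp hq mu_bnd la_bnd bezout).
exact: (coef_set_opp hp hq mu_bnd la_bnd bezout).
Qed.
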